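(* Let $k_0\in\mathbb{Z}$. Then there exist unique functions $M_+(\cdot,k_0)$ and $M_-(\cdot,k_0)$ such that for all $z\in\mathbb{C}\setminus(\partial\mathbb{D}\cup\{0\})$, $$\binom{u_\pm(z,\cdot,k_0)}{v_\pm(z,\cdot,k_0)}:=\binom{q_+(z,\cdot,k_0)}{s_+(z,\cdot,k_0)}+M_\pm(z,k_0)\binom{p_+(z,\cdot,k_0)}{r_+(z,\cdot,k_0)}\in\ell^2([k_0,\pm\infty)\cap\mathbb{Z})^2.$$
   Context: $\mathbb{D}$ is the open unit disk in $\mathbb{C}$ and $\partial\mathbb{D}$ the unit circle. Let $\{\alpha_k\}_{k\in\mathbb{Z}}\subset\mathbb{D}$ and $\rho_k=\sqrt{1-|\alpha_k|^2}$. $[k_0,-\infty)\cap\mathbb{Z}$ means $(-\infty,k_0]\cap\mathbb{Z}$. For $z\in\mathbb{C}\setminus\{0\}$, put $T(z,k)=\frac1{\rho_k}\begin{pmatrix}\alpha_k&z\\1/z&\overline{\alpha_k}\end{pmatrix}$ for $k$ odd and $T(z,k)=\frac1{\rho_k}\begin{pmatrix}\overline{\alpha_k}&1\\1&\alpha_k\end{pmatrix}$ for $k$ even. The Laurent polynomials $p_+,r_+,q_+,s_+$ (in $z$) are defined for all $k\in\mathbb{Z}$ by requiring that $(u,v)=(p_+,r_+)$ and $(u,v)=(q_+,s_+)$ solve $\binom{u(z,k,k_0)}{v(z,k,k_0)}=T(z,k)\binom{u(z,k-1,k_0)}{v(z,k-1,k_0)}$, $k\in\mathbb{Z}$, with initial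 values at $k=k_0$: $\binom{p_+}{r_+}=\binom{z}{1}$, $\binom{q_+}{s_+}=\binom{z}{-1}$ if $k_0$ is odd, and $\binom{p_+}{r_+}=\binom{1}{1}$, $\binom{q_+}{s_+}=\binom{-1}{1}$ if $k_0$ is even. *)

(* Defs.v *)
From Stdlib Require Import Reals ZArith Lia Lra.
From Coquelicot Require Import Coquelicot.

Open Scope C_scope.

Section Transfer.

Variable alpha : Z -> C.

Definition rho (k : Z) : R := sqrt (1 - Cmod (alpha k) ^ 2).

(* Coquelicot has no multiplication of a matrix by an element of its ring. *)
Definition Mscal {m n : nat} (c : C) (A : @matrix C m n) : @matrix C m n :=
  mk_matrix m n (fun i j => c * coeff_mat (RtoC 0) A i j).

Definition T (z : C) (k : Z) : @matrix C 2 2 :=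
  if Z.odd k
  then @Mscal 2 2 (1 / rho k) [[alpha k, z], [1 / z, Cconj (alpha k)]]
  else @Mscal 2 2 (1 / rho k) [[Cconj (alpha k), RtoC 1], [RtoC 1, alpha k]].

Definition is_solution (z : C) (u v : Z -> C) : Prop :=
  forall k : Z,
    ([[u k], [v k]] : @matrix C 2 1)
    = @Mmult C_Ring 2 2 1 (T z k) [[u (k - 1)%Z], [v (k - 1)%Z]].

(* [p z k] stands for p_+(z,k,k0), and similarly for [r], [q], [s].  Nothing is
   required at z = 0.  For z <> 0 such functions exist and are unique, by
   [solution_exists] and [solution_unique] below. *)
Definition laurent_system (k0 : Z) (p r q s : C -> Z -> C) : Prop :=
  forall z : C, z <> RtoC 0 ->
    is_solution z (p z) (r z) /\
    is_solution z (q z) (s z) /\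
    (if Z.odd k0
     then p z k0 = z /\ r z k0 = RtoC 1 /\ q z k0 = z /\ s z k0 = - RtoC 1
     else p z k0 = RtoC 1 /\ r z k0 = RtoC 1 /\
          q z k0 = - RtoC 1 /\ s z k0 = RtoC 1).

End Transfer.

Definition ell2_right (k0 : Z) (f : Z -> C) : Prop :=
  ex_series (fun n : nat => (Cmod (f (k0 + Z.of_nat n)%Z) ^ 2)%R).

Definition ell2_left (k0 : Z) (f : Z -> C) : Prop :=
  ex_series (fun n : nat => (Cmod (f (k0 - Z.of_nat n)%Z) ^ 2)%R).

Definition off_circle : Type := {z : C | z <> RtoC 0 /\ Cmod z <> 1%R}.

Definition point (z : off_circle) : C := proj1_sig z.

Section SolutionTheory.

Variable alpha : Z -> C.
Hypothesis alpha_disk : forall k, (Cmod (alpha k) < 1)%R.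

Lemma rho_pos k : (0 < rho alpha k)%R.
Proof.
  apply sqrt_lt_R0. pose proof (Cmod_ge_0 (alpha k)). specialize (alpha_disk k). nra.
Qed.

Lemma rho_sqr k : RtoC (rho alpha k) * rho alpha k = 1 - alpha k * Cconj (alpha k).
Proof.
  assert (H : (Cmod (alpha k) ^ 2 = fst (alpha k) ^ 2 + snd (alpha k) ^ 2)%R).
  { unfold Cmod. rewrite <- Rsqr_pow2, Rsqr_sqrt; [reflexivity | nra]. }
  rewrite <- RtoC_mult. unfold rho. rewrite sqrt_sqrt.
  - rewrite H. unfold RtoC, Cminus, Cplus, Copp, Cmult, Cconj; simpl.
    apply injective_projections; simpl; ring.
  - pose proof (Cmod_ge_0 (alpha k)). specialize (alpha_disk k). nra.
Qed.

Lemma rho_neq0 k : RtoC (rho alpha k) <> RtoC 0.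
Proof. pose proof (rho_pos k). intros E. apply RtoC_inj in E. lra. Qed.

Definition step (z : C) (k : Z) (w : C * C) : C * C :=
  let (u, v) := w in
  if Z.odd k
  then ((alpha k * u + z * v) / rho alpha k,
        (1 / z * u + Cconj (alpha k) * v) / rho alpha k)
  else ((Cconj (alpha k) * u + v) / rho alpha k,
        (u + alpha k * v) / rho alpha k).

Definition unstep (z : C) (k : Z) (w : C * C) : C * C :=
  let (u, v) := w in
  if Z.odd k
  then ((z * v - Cconj (alpha k) * u) / rho alpha k,
        (1 / z * u - alpha k * v) / rho alpha k)
  else ((v - alpha k * u) / rho alpha k,
        (u - Cconj (alpha k) * v) / rho alpha k).

Lemma is_solution_step (z : C) (u v : Z -> C) :
  is_solution alpha z u v <->
  forall k, (u k, v k) = step z k (u (k - 1)%Z, v (k - 1)%Z).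
Proof.
  assert (E : forall k (a b : C), @Mmult C_Ring 2 2 1 (T alpha z k) [[a], [b]]
    = ([[fst (step z k (a, b))], [snd (step z k (a, b))]] : @matrix C 2 1)).
  { intros k a b. pose proof (rho_neq0 k).
    unfold T, step; destruct (Z.odd k);
    unfold Mmult, Mscal, mk_matrix, coeff_mat; simpl;
    rewrite !sum_Sn, !sum_O; unfold plus, mult; simpl;
    unfold Cdiv;
    match goal with |- (pair (pair ?x1 tt) (pair (pair ?x2 tt) tt))
                     = (pair (pair ?y1 tt) (pair (pair ?y2 tt) tt)) =>
      assert (E1 : @eq C x1 y1) by ring; assert (E2 : @eq C x2 y2) by ring end;
    now rewrite E1, E2. }
  unfold is_solution. split; intros H k; specialize (H k); rewrite ?E in *.
  - injection H as H1 H2. rewrite H1, H2. symmetry. apply surjective_pairing.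
  - now rewrite <- H.
Qed.

Lemma step_unstep (z : C) k w : z <> RtoC 0 -> step z k (unstep z k w) = w.
Proof.
  intros Hz. pose proof (rho_neq0 k) as Hr. pose proof (rho_sqr k) as Hs.
  assert (D : forall x : C, (1 - alpha k * Cconj (alpha k)) * x
                        / (rho alpha k * rho alpha k) = x).
  { intros x. rewrite <- Hs. now field. }
  destruct w as [u v]. unfold step, unstep; destruct (Z.odd k); f_equal.
  - transitivity ((1 - alpha k * Cconj (alpha k)) * u / (rho alpha k * rho alpha k));
      [now field | apply D].
  - transitivity ((1 - alpha k * Cconj (alpha k)) * v / (rho alpha k * rho alpha k));
      [now field | apply D].
  - transitivity ((1 - alpha k * Cconj (alpha k)) * u / (rho alpha k * rho alpha k));
      [now field | apply D].
  - transitivity ((1 - alpha k * Cconj (alpha k)) * v / (rho alpha k * rho alpha k));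
      [now field | apply D].
Qed.

Lemma unstep_step (z : C) k w : z <> RtoC 0 -> unstep z k (step z k w) = w.
Proof.
  intros Hz. pose proof (rho_neq0 k) as Hr. pose proof (rho_sqr k) as Hs.
  assert (D : forall x : C, (1 - alpha k * Cconj (alpha k)) * x
                        / (rho alpha k * rho alpha k) = x).
  { intros x. rewrite <- Hs. now field. }
  destruct w as [u v]. unfold step, unstep; destruct (Z.odd k); f_equal.
  - transitivity ((1 - alpha k * Cconj (alpha k)) * u / (rho alpha k * rho alpha k));
      [now field | apply D].
  - transitivity ((1 - alpha k * Cconj (alpha k)) * v / (rho alpha k * rho alpha k));
      [now field | apply D].
  - transitivity ((1 - alpha k * Cconj (alpha k)) * u / (rho alpha k * rho alpha k));
      [now field | apply D].
  - transitivity ((1 - alpha k * Cconj (alpha k)) * v / (rho alpha k * rho alpha k));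
      [now field | apply D].
Qed.

Lemma solution_exists (z : C) (k0 : Z) (a b : C) : z <> RtoC 0 ->
  exists u v, is_solution alpha z u v /\ u k0 = a /\ v k0 = b.
Proof.
  intros Hz.
  pose (fwd := fix fwd n := match n with
    | O => (a, b) | S m => step z (k0 + Z.of_nat (S m)) (fwd m) end).
  pose (bwd := fix bwd n := match n with
    | O => (a, b) | S m => unstep z (k0 - Z.of_nat m) (bwd m) end).
  assert (fwdS : forall n, fwd (S n) = step z (k0 + Z.of_nat (S n)) (fwd n))
    by reflexivity.
  assert (bwdS : forall n, bwd (S n) = unstep z (k0 - Z.of_nat n) (bwd n))
    by reflexivity.
  pose (f := fun k => if (k0 <=? k)%Z then fwd (Z.to_nat (k - k0))
                      else bwd (Z.to_nat (k0 - k))).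
  assert (F0 : f k0 = (a, b)).
  { unfold f. now rewrite Z.leb_refl, Z.sub_diag. }
  exists (fun k => fst (f k)), (fun k => snd (f k)).
  rewrite F0. repeat split. apply is_solution_step. intros k.
  rewrite <- !surjective_pairing. unfold f.
  destruct (Z.leb_spec k0 k) as [L|L]; destruct (Z.leb_spec k0 (k - 1)) as [L'|L'].
  - replace (Z.to_nat (k - k0)) with (S (Z.to_nat (k - 1 - k0))) by lia.
    rewrite fwdS. f_equal. lia.
  - replace (Z.to_nat (k - k0)) with O by lia.
    replace (Z.to_nat (k0 - (k - 1))) with 1%nat by lia.
    change (fwd O) with (a, b). change (bwd 1%nat) with (unstep z (k0 - 0) (a, b)).
    replace (k0 - 0)%Z with k by lia. now rewrite step_unstep.
  - lia.
  - replace (Z.to_nat (k0 - (k - 1))) with (S (Z.to_nat (k0 - k))) by lia.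
    rewrite bwdS. replace (k0 - Z.of_nat (Z.to_nat (k0 - k)))%Z with k by lia.
    now rewrite step_unstep.
Qed.

Lemma solution_unique (z : C) (k0 : Z) (u v u' v' : Z -> C) : z <> RtoC 0 ->
  is_solution alpha z u v -> is_solution alpha z u' v' ->
  u k0 = u' k0 -> v k0 = v' k0 ->
  forall k, u k = u' k /\ v k = v' k.
Proof.
  intros Hz H H' Eu Ev. rewrite is_solution_step in H, H'.
  assert (B : forall k, (u (k - 1), v (k - 1))%Z = unstep z k (u k, v k)).
  { intros k. now rewrite (H k), unstep_step. }
  assert (B' : forall k, (u' (k - 1), v' (k - 1))%Z = unstep z k (u' k, v' k)).
  { intros k. now rewrite (H' k), unstep_step. }
  assert (P : forall n : nat, u (k0 + Z.of_nat n)%Z = u' (k0 + Z.of_nat n)%Z /\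
                     v (k0 + Z.of_nat n)%Z = v' (k0 + Z.of_nat n)%Z).
  { induction n as [|n [I1 I2]].
    - now rewrite Z.add_0_r.
    - specialize (H (k0 + Z.of_nat (S n))%Z). specialize (H' (k0 + Z.of_nat (S n))%Z).
      replace (k0 + Z.of_nat (S n) - 1)%Z with (k0 + Z.of_nat n)%Z in H, H' by lia.
      rewrite I1, I2, <- H' in H. now injection H. }
  assert (N : forall n : nat, u (k0 - Z.of_nat n)%Z = u' (k0 - Z.of_nat n)%Z /\
                     v (k0 - Z.of_nat n)%Z = v' (k0 - Z.of_nat n)%Z).
  { induction n as [|n [I1 I2]].
    - now rewrite Z.sub_0_r.
    - specialize (B (k0 - Z.of_nat n)%Z). specialize (B' (k0 - Z.of_nat n)%Z).
      replace (k0 - Z.of_nat n - 1)%Z with (k0 - Z.of_nat (S n))%Z in B, B' by lia.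
      rewrite I1, I2, <- B' in B. now injection B. }
  intros k. destruct (Z.le_ge_cases k0 k).
  - specialize (P (Z.to_nat (k - k0))).
    now replace (k0 + Z.of_nat (Z.to_nat (k - k0)))%Z with k in P by lia.
  - specialize (N (Z.to_nat (k0 - k))).
    now replace (k0 - Z.of_nat (Z.to_nat (k0 - k)))%Z with k in N by lia.
Qed.

End SolutionTheory.

(* Main.v *)
Require Import Defs.
From Stdlib Require Import Reals ZArith.
From Coquelicot Require Import Coquelicot.
From Stdlib Require Import Lra Lia FunctionalExtensionality ClassicalEpsilon.

(** Every solution satisfies
    [|u_k|^2 + |u_{k-1}|^2 = w_k (|v_k|^2 + |v_{k-1}|^2)], with [w_k = |z|^2] for odd [k]
    and [w_k = 1] for even [k].  Hence, with [t] one of the two weights and [tau] the other,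
    the indefinite form [|u|^2 - t|v|^2] taken along every second site changes by
    [(t - tau)(|v|^2 + |v'|^2)].  The solution [(p, r)] is isotropic at [k0], and so its
    form stays away from [0]: it is not square summable, which gives uniqueness.  For
    existence, choose [M_n] such that [q + M_n p] vanishes at the [n]-th site; then the form
    of the combined solution has a sign there, which bounds the [M_n] and the square sums up
    to that site, and a limit point of the [M_n] is the required coefficient. *)

Local Open Scope C_scope.

(** * Limits of real sequences and convergent subsequences of bounded complex ones *)

Lemma Cmod_sqr (x : C) : (Cmod x ^ 2 = fst x ^ 2 + snd x ^ 2)%R.
Proof.
  unfold Cmod. rewrite <- Rsqr_pow2, Rsqr_sqrt; [reflexivity | nra].
Qed.

Lemma is_lim_seq_inv_INR_S : is_lim_seq (fun n => / (INR n + 1))%R 0.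
Proof.
  apply is_lim_seq_ext with (fun n => / INR (S n))%R.
  { intros n. now rewrite S_INR. }
  apply -> (is_lim_seq_incr_1 (fun n => / INR n)%R).
  apply (is_lim_seq_inv _ p_infty); [apply is_lim_seq_INR | easy].
Qed.

Lemma is_lim_seq_dist (x e : nat -> R) (a : R) :
  (forall n, Rabs (x n - a) <= e n)%R -> is_lim_seq e 0 -> is_lim_seq x a.
Proof.
  intros H He.
  apply is_lim_seq_le_le with (fun n => a - e n)%R (fun n => a + e n)%R.
  - intros n. specialize (H n). apply Rabs_le_between in H. lra.
  - replace a with (a - 0)%R at 1 by ring.
    apply is_lim_seq_minus'; [apply is_lim_seq_const | exact He].
  - replace a with (a + 0)%R at 1 by ring.
    apply is_lim_seq_plus'; [apply is_lim_seq_const | exact He].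
Qed.

Lemma is_lim_seq_reindex (x : nat -> R) (a : R) (phi : nat -> nat) :
  (forall n, (n <= phi n)%nat) -> is_lim_seq x a -> is_lim_seq (fun n => x (phi n)) a.
Proof.
  intros Hphi. apply is_lim_seq_subseq.
  intros P [N HN]. exists N. intros n Hn. apply HN. specialize (Hphi n). lia.
Qed.

(** Bolzano-Weierstrass gives a cluster point [a], and [phi n] is picked beyond [n] with error below
    [1/(n+1)]. The map [phi] need not be increasing: [n <= phi n] is enough to pass limits along
    it. *)
Lemma bounded_subsequence_R (x : nat -> R) (K : R) :
  (forall n, Rabs (x n) <= K)%R ->
  exists (phi : nat -> nat) (a : R),
    (forall n, (n <= phi n)%nat) /\ is_lim_seq (fun n => x (phi n)) a.
Proof.
  intros Hx.
  destruct (Bolzano_Weierstrass x (fun y => - K <= y <= K)%R (compact_P3 _ _))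
    as [a Ha].
  { intros n. now apply Rabs_le_between. }
  assert (E : forall n : nat, exists m, (n <= m)%nat /\ (Rabs (x m - a) < / (INR n + 1))%R).
  { intros n. pose proof (pos_INR n).
    assert (Hp : (0 < / (INR n + 1))%R) by (apply Rinv_0_lt_compat; lra).
    apply (Ha (fun y => Rabs (y - a) < / (INR n + 1))%R).
    exists (mkposreal _ Hp). intros y Hy. exact Hy. }
  exists (fun n => proj1_sig (constructive_indefinite_description _ (E n))), a.
  assert (P := fun n => proj2_sig (constructive_indefinite_description _ (E n))).
  split; [intros n; apply (P n) |].
  apply is_lim_seq_dist with (2 := is_lim_seq_inv_INR_S).
  intros n. apply Rlt_le, (P n).
Qed.

Lemma bounded_subsequence_C (x : nat -> C) (K : R) :
  (forall n, Cmod (x n) <= K)%R ->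
  exists (phi : nat -> nat) (a : C),
    (forall n, (n <= phi n)%nat) /\ is_lim_seq (fun n => Cmod (x (phi n) - a)) 0.
Proof.
  intros Hx.
  destruct (bounded_subsequence_R (fun n => fst (x n)) K) as (f & a & Hf & La).
  { intros n. eapply Rle_trans; [| apply (Hx n)].
    eapply Rle_trans; [apply Rmax_l | apply Rmax_Cmod]. }
  destruct (bounded_subsequence_R (fun n => snd (x (f n))) K) as (g & b & Hg & Lb).
  { intros n. eapply Rle_trans; [| apply (Hx (f n))].
    eapply Rle_trans; [apply Rmax_r | apply Rmax_Cmod]. }
  exists (fun n => f (g n)), (a, b). split.
  { intros n. specialize (Hg n). specialize (Hf (g n)). lia. }
  apply (is_lim_seq_reindex _ _ g Hg) in La.
  apply is_lim_seq_dist with (fun n => sqrt 2 *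
    (Rabs (fst (x (f (g n))) - a) + Rabs (snd (x (f (g n))) - b)))%R.
  - intros n. rewrite Rminus_0_r, Rabs_pos_eq by apply Cmod_ge_0.
    eapply Rle_trans; [apply Cmod_2Rmax |].
    apply Rmult_le_compat_l; [apply sqrt_pos |].
    change (fst (x (f (g n)) - (a, b))%C) with (fst (x (f (g n))) - a)%R.
    change (snd (x (f (g n)) - (a, b))%C) with (snd (x (f (g n))) - b)%R.
    apply Rmax_lub; [pose proof (Rabs_pos (snd (x (f (g n))) - b))
                    | pose proof (Rabs_pos (fst (x (f (g n))) - a))]; lra.
  - assert (D : forall (y : nat -> R) (c : R), is_lim_seq y c ->
      is_lim_seq (fun n => Rabs (y n - c)) 0).
    { intros y c Hy. apply -> is_lim_seq_abs_0. replace 0%R with (c - c)%R by ring.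
      apply is_lim_seq_minus'; [exact Hy | apply is_lim_seq_const]. }
    replace 0%R with (sqrt 2 * (0 + 0))%R by ring.
    apply (is_lim_seq_scal_l _ _ (Finite (0 + 0))).
    apply is_lim_seq_plus'; [apply (D _ _ La) | apply (D _ _ Lb)].
Qed.

Lemma is_lim_seq_sum_n (f : nat -> nat -> R) (g : nat -> R) (N : nat) :
  (forall j, is_lim_seq (fun n => f n j) (g j)) ->
  is_lim_seq (fun n => sum_n (f n) N) (sum_n g N).
Proof.
  intros H. induction N as [|N IH].
  - rewrite sum_O. apply is_lim_seq_ext with (2 := H O). intros n. now rewrite sum_O.
  - rewrite sum_Sn. apply is_lim_seq_ext with (fun n => sum_n (f n) N + f n (S N))%R.
    { intros n. now rewrite sum_Sn. }
    now apply is_lim_seq_plus'.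
Qed.

Lemma Cmod_reverse_triangle (x y : C) : (Cmod y - Cmod x <= Cmod (x + y))%R.
Proof.
  pose proof (Cmod_triangle (x + y) (- x)) as H. rewrite Cmod_opp in H.
  replace (x + y + - x) with y in H by ring. lra.
Qed.

(** The two moduli differ by at most [|M n - m| |b|]. This carries the value at each fixed site to
    the limit coefficient. *)
Lemma is_lim_seq_Cmod_affine (M : nat -> C) (m a b : C) :
  is_lim_seq (fun n => Cmod (M n - m)) 0 ->
  is_lim_seq (fun n => Cmod (a + M n * b)) (Cmod (a + m * b)).
Proof.
  intros H. apply is_lim_seq_dist with (fun n => Cmod (M n - m) * Cmod b)%R.
  - intros n. rewrite <- Cmod_mult. apply Rabs_le.
    pose proof (Cmod_triangle (a + m * b) ((M n - m) * b)) as H1.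
    pose proof (Cmod_reverse_triangle ((M n - m) * b) (a + m * b)) as H2.
    replace (a + m * b + (M n - m) * b) with (a + M n * b) in H1 by ring.
    replace ((M n - m) * b + (a + m * b)) with (a + M n * b) in H2 by ring.
    lra.
  - replace 0%R with (0 * Cmod b)%R by ring.
    apply (is_lim_seq_scal_r _ _ (Finite 0)), H.
Qed.

(** * Pairs of sequences with alternating weights and their indefinite form *)

Definition norm2 (u : nat -> C) (n : nat) : R := (Cmod (u n) ^ 2)%R.

Definition combine (q p : nat -> C) (M : C) (n : nat) : C := q n + M * p n.

(** A half-line is indexed by [nat] from its starting site, so that both directions are treated
    alike. Steps leaving an even index have weight [tau], those leaving an odd index have weight
    [t]; the form of weight [t] is read at even indices. *)
Definition alternating (tau t : R) (u v : nat -> C) : Prop :=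
  forall n,
    (norm2 u (2 * n) + norm2 u (S (2 * n))
       = tau * (norm2 v (2 * n) + norm2 v (S (2 * n))))%R /\
    (norm2 u (S (2 * n)) + norm2 u (2 * S n)
       = t * (norm2 v (S (2 * n)) + norm2 v (2 * S n)))%R.

(** Inverting the weights reverses their order, which reduces the case [t < tau] to [tau < t]. *)
Lemma alternating_swap (tau t : R) (u v : nat -> C) :
  tau <> 0%R -> t <> 0%R -> alternating tau t u v -> alternating (/ tau) (/ t) v u.
Proof.
  intros Htau Ht H n. destruct (H n) as [H1 H2]. rewrite H1, H2.
  split; now field.
Qed.

Lemma norm2_ge0 (u : nat -> C) (n : nat) : (0 <= norm2 u n)%R.
Proof. apply pow2_ge_0. Qed.

(** The sites [0, ..., 2n+1] split into the pairs joined by [tau]-steps. *)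
Lemma alternating_sum (tau t : R) (u v : nat -> C) : alternating tau t u v ->
  forall n, sum_n (norm2 u) (S (2 * n)) = (tau * sum_n (norm2 v) (S (2 * n)))%R.
Proof.
  intros H n. induction n as [|n IH].
  - rewrite !sum_Sn, !sum_O. apply (proj1 (H O)).
  - destruct (H (S n)) as [H1 _].
    replace (2 * S n)%nat with (S (S (2 * n))) in * by lia.
    rewrite !(sum_Sn _ (S (S (2 * n)))), !(sum_Sn _ (S (2 * n))), IH.
    unfold plus; simpl in *. lra.
Qed.

(* The form [|u|^2 - t|v|^2] changes sign across every [t]-step; across a
   [tau]-step it does so up to the increment [(t - tau)(|v|^2 + |v'|^2)]. *)
Lemma alternating_form (tau t : R) (u v : nat -> C) : alternating tau t u v ->
  forall n, (norm2 u (2 * S n) - t * norm2 v (2 * S n)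
    = norm2 u 0 - t * norm2 v 0 + (t - tau) * sum_n (norm2 v) (S (2 * n)))%R.
Proof.
  intros H n. induction n as [|n IH].
  - destruct (H O) as [H1 H2]. rewrite !sum_Sn, !sum_O.
    change (2 * 0)%nat with O in *. unfold plus; simpl in *. lra.
  - destruct (H (S n)) as [H1 H2].
    replace (S (2 * S n)) with (S (S (S (2 * n)))) in * by lia.
    rewrite !(sum_Sn _ (S (S (2 * n)))), !(sum_Sn _ (S (2 * n))).
    replace (2 * S n)%nat with (S (S (2 * n))) in * by lia.
    change plus with Rplus. lra.
Qed.

Lemma sum_n_norm2_incr (u : nat -> C) (n m : nat) :
  (n <= m)%nat -> (sum_n (norm2 u) n <= sum_n (norm2 u) m)%R.
Proof.
  intros L. induction L as [|m L IH]; [lra |].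
  rewrite sum_Sn. change plus with Rplus. pose proof (norm2_ge0 u (S m)). lra.
Qed.

Definition square_summable (u : nat -> C) : Prop := ex_series (norm2 u).

Lemma square_summable_bounded (u : nat -> C) (K : R) :
  (forall n, sum_n (norm2 u) (S (2 * n)) <= K)%R -> square_summable u.
Proof.
  intros H.
  destruct (ex_finite_lim_seq_incr (sum_n (norm2 u)) K) as [l Hl].
  { intros n. apply sum_n_norm2_incr. lia. }
  { intros n. eapply Rle_trans; [apply (sum_n_norm2_incr u n (S (2 * n))); lia | apply H]. }
  now exists l.
Qed.

Lemma norm2_0_le_sum_n (u : nat -> C) (n : nat) : (norm2 u 0 <= sum_n (norm2 u) n)%R.
Proof.
  rewrite <- (sum_O (norm2 u)) at 1. apply sum_n_norm2_incr. lia.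
Qed.

Lemma alternating_not_summable (tau t : R) (p r : nat -> C) :
  (tau < t)%R -> alternating tau t p r -> norm2 p 0 = (t * norm2 r 0)%R ->
  r O <> RtoC 0 -> square_summable p -> square_summable r -> False.
Proof.
  intros Htt Hpr H0 Hr0 Sp Sr.
  apply ex_series_lim_0 in Sp, Sr.
  assert (L : is_lim_seq (fun n => norm2 p (2 * S n) - t * norm2 r (2 * S n))%R (0 - t * 0)%R).
  { apply is_lim_seq_minus'.
    - apply (is_lim_seq_reindex _ _ (fun n => (2 * S n)%nat)) with (2 := Sp). lia.
    - apply (is_lim_seq_scal_l _ t (Finite 0)).
      apply (is_lim_seq_reindex _ _ (fun n => (2 * S n)%nat)) with (2 := Sr). lia. }
  assert (B : (0 < (t - tau) * norm2 r 0)%R).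
  { apply Rmult_lt_0_compat; [lra |]. unfold norm2. apply pow_lt, Cmod_gt_0, Hr0. }
  apply (is_lim_seq_le (fun _ => (t - tau) * norm2 r 0)%R _ ((t - tau) * norm2 r 0)%R)
    in L; [simpl in L; lra | | apply is_lim_seq_const].
  intros n. rewrite (alternating_form _ _ _ _ Hpr), H0.
  pose proof (norm2_0_le_sum_n r (S (2 * n))). nra.
Qed.

(* In terms of [y = s + M r] the condition reads
   [d|y|^2 <= t|y|^2 - |c + (p/r) y|^2] with [|p/r|^2 = t], whose right-hand side grows at
   most linearly in [|y|]. *)
Lemma initial_disk_bounded (t d : R) (p r q s : C) :
  (0 < t)%R -> (0 < d)%R -> (Cmod p ^ 2 = t * Cmod r ^ 2)%R -> r <> RtoC 0 ->
  exists K : R, forall M,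
    (Cmod (q + M * p) ^ 2 - t * Cmod (s + M * r) ^ 2 + d * Cmod (s + M * r) ^ 2 <= 0)%R ->
    (Cmod M <= K)%R.
Proof.
  intros Ht Hd Hp Hr.
  assert (Hr' : (0 < Cmod r)%R) by now apply Cmod_gt_0.
  set (l := p / r). set (c := q - s * l).
  assert (Hl : (Cmod l ^ 2 = t)%R).
  { unfold l. rewrite Cmod_div by easy.
    replace ((Cmod p / Cmod r) ^ 2)%R with (Cmod p ^ 2 / Cmod r ^ 2)%R by (field; lra).
    rewrite Hp. field. lra. }
  (* The first summand is the bound for [|y|] proved below; then [M r = y - s] bounds [M]. *)
  exists ((2 * Cmod c * Cmod l / d + Cmod s) / Cmod r)%R. intros M H.
  set (y := s + M * r) in *.
  assert (E : q + M * p = c + l * y).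
  { unfold c, y, l. now field. }
  pose proof (Cmod_reverse_triangle c (l * y)) as H1. rewrite <- E, Cmod_mult in H1.
  pose proof (Cmod_reverse_triangle s (M * r)) as H2. rewrite Cmod_mult in H2.
  fold y in H2. rewrite <- Hl in H.
  pose proof (Cmod_ge_0 y). pose proof (Cmod_ge_0 c). pose proof (Cmod_ge_0 l).
  pose proof (Cmod_ge_0 (q + M * p)).
  assert (Y : (Cmod y <= 2 * Cmod c * Cmod l / d)%R).
  { apply Rle_div_r; [exact Hd |].
    destruct (Rle_lt_dec (Cmod y * d) (2 * Cmod c * Cmod l)) as [|G]; [assumption |].
    exfalso.
    assert (Y0 : (0 < Cmod y)%R) by nra.
    assert (G' : (2 * Cmod c * Cmod l * Cmod y < d * Cmod y ^ 2)%R) by nra.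
    (* The reverse triangle inequality can be squared only if [|c| <= |l y|]. Otherwise
       [|l y|^2 <= |c| |l y|] already bounds [d |y|^2]. *)
    destruct (Rle_lt_dec (Cmod c) (Cmod l * Cmod y)) as [L | L].
    - assert ((Cmod l * Cmod y - Cmod c) ^ 2 <= Cmod (q + M * p) ^ 2)%R
        by (apply pow_incr; lra).
      nra.
    - assert (0 <= Cmod l * Cmod y)%R by nra.
      assert (Cmod l * Cmod y * (Cmod l * Cmod y) <= Cmod c * (Cmod l * Cmod y))%R
        by (apply Rmult_le_compat_r; lra).
      nra. }
  apply Rle_div_r; [exact Hr' |]. lra.
Qed.

(** * Existence of the coefficient as a limit point *)

Lemma square_summable_coefficient_exists (tau t : R) (p r q s : nat -> C) :
  (0 < tau < t)%R -> alternating tau t p r ->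
  (forall M, alternating tau t (combine q p M) (combine s r M)) ->
  norm2 p 0 = (t * norm2 r 0)%R -> r O <> RtoC 0 ->
  exists M, square_summable (combine q p M) /\ square_summable (combine s r M).
Proof.
  intros Htt Hpr Hqs H0 Hr0.
  assert (Hr : (0 < norm2 r 0)%R) by (apply pow_lt, Cmod_gt_0, Hr0).
  assert (Hp : forall n, p (2 * S n)%nat <> RtoC 0).
  (* A zero of [p] would make the form at this site nonpositive, whereas it is at least
     [(t - tau) |r_0|^2 > 0]. *)
  { intros n E. pose proof (alternating_form _ _ _ _ Hpr n) as F.
    rewrite H0 in F. unfold norm2 at 1 in F. rewrite E, Cmod_0 in F.
    pose proof (norm2_0_le_sum_n r (S (2 * n))).
    pose proof (norm2_ge0 r (2 * S n)). nra. }
  destruct (initial_disk_bounded t (t - tau) (p O) (r O) (q O) (s O)) as [K HK];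
    [lra | lra | exact H0 | exact Hr0 |].
  set (M := fun n => - q (2 * S n)%nat / p (2 * S n)%nat).
  assert (HM : forall n, (norm2 (combine q p (M n)) 0 - t * norm2 (combine s r (M n)) 0
      + (t - tau) * sum_n (norm2 (combine s r (M n))) (S (2 * n)) <= 0)%R).
  { intros n. rewrite <- (alternating_form _ _ _ _ (Hqs (M n))).
    pose proof (norm2_ge0 (combine s r (M n)) (2 * S n)).
    assert (E : norm2 (combine q p (M n)) (2 * S n) = 0%R).
    { unfold norm2, combine, M. specialize (Hp n).
      replace (q (2 * S n)%nat + - q (2 * S n)%nat / p (2 * S n)%nat * p (2 * S n)%nat)
        with (RtoC 0) by now field.
      rewrite Cmod_0. ring. }
    rewrite E. nra. }
  assert (BM : forall n, (Cmod (M n) <= K)%R).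
  (* Only the term at site [0] of the sum in [HM] is kept, which leaves the condition of
     [initial_disk_bounded] with [d = t - tau]. *)
  { intros n. apply HK. specialize (HM n).
    pose proof (norm2_0_le_sum_n (combine s r (M n)) (S (2 * n))).
    unfold norm2 at 1 2, combine at 1 2 in HM.
    change (Cmod (s O + M n * r O) ^ 2)%R with (norm2 (combine s r (M n)) 0) at 2.
    nra. }
  destruct (bounded_subsequence_C M K BM) as (phi & m & Hphi & Lm).
  assert (L : forall a b j, is_lim_seq (fun n => norm2 (combine a b (M (phi n))) j)
                                       (norm2 (combine a b m) j)).
  { intros a b j. unfold norm2.
    pose proof (is_lim_seq_Cmod_affine _ _ (a j) (b j) Lm) as A.
    apply is_lim_seq_ext with
      (fun n => Cmod (a j + M (phi n) * b j) * Cmod (a j + M (phi n) * b j))%R.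
    { intros n. unfold combine. ring. }
    replace (Cmod (combine a b m j) ^ 2)%R
      with (Cmod (a j + m * b j) * Cmod (a j + m * b j))%R by (unfold combine; ring).
    now apply is_lim_seq_mult'. }
  assert (B : forall N, ((t - tau) * sum_n (norm2 (combine s r m)) (S (2 * N))
                         <= t * norm2 (combine s r m) 0)%R).
  (* With [N] fixed, the sum up to [2N+1] is part of the sum in [HM (phi n)] as soon as [n >= N],
     because [n <= phi n]. The bound involves finitely many sites and survives the limit in [n]. *)
  { intros N.
    assert (L1 := is_lim_seq_scal_l _ (t - tau) _
      (is_lim_seq_sum_n _ _ (S (2 * N)) (L s r))).
    assert (L2 := is_lim_seq_scal_l _ t _ (L s r O)).
    refine (is_lim_seq_le_loc _ _ _ _ _ L1 L2).
    exists N. intros n Hn. specialize (HM (phi n)). specialize (Hphi n).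
    pose proof (norm2_ge0 (combine q p (M (phi n))) 0).
    assert (sum_n (norm2 (combine s r (M (phi n)))) (S (2 * N))
            <= sum_n (norm2 (combine s r (M (phi n)))) (S (2 * phi n)))%R
      by (apply sum_n_norm2_incr; lia).
    change (fun j => norm2 (combine s r (M (phi n))) j)
      with (norm2 (combine s r (M (phi n)))).
    nra. }
  assert (B' : forall N, (sum_n (norm2 (combine s r m)) (S (2 * N))
                          <= t * norm2 (combine s r m) 0 / (t - tau))%R).
  { intros N. apply Rle_div_r; [lra |]. specialize (B N). lra. }
  exists m. split.
  - apply square_summable_bounded with (tau * (t * norm2 (combine s r m) 0 / (t - tau)))%R.
    intros n. rewrite (alternating_sum _ _ _ _ (Hqs m)).
    apply Rmult_le_compat_l; [lra | apply B'].
  - exact (square_summable_bounded _ _ B').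
Qed.

(** * Uniqueness of the coefficient *)

(** The [q] terms cancel in the difference of the two combinations, and
    [|a - b|^2 <= 2|a|^2 + 2|b|^2]. Two distinct admissible coefficients would thus make [p] itself
    square summable. *)
Lemma norm2_combine_sub (q p : nat -> C) (M M' : C) (n : nat) :
  (Cmod (M - M') ^ 2 * norm2 p n
     <= 2 * norm2 (combine q p M) n + 2 * norm2 (combine q p M') n)%R.
Proof.
  unfold norm2, combine. rewrite <- Rpow_mult_distr, <- Cmod_mult.
  set (a := q n + M * p n). set (b := q n + M' * p n).
  replace ((M - M') * p n) with (a + - b) by (unfold a, b; ring).
  pose proof (Cmod_triangle a (- b)) as H. rewrite Cmod_opp in H.
  pose proof (Cmod_ge_0 (a + - b)).
  assert (Cmod (a + - b) ^ 2 <= (Cmod a + Cmod b) ^ 2)%R by (apply pow_incr; lra).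
  pose proof (pow2_ge_0 (Cmod a - Cmod b)). nra.
Qed.

Lemma square_summable_combine_sub (q p : nat -> C) (M M' : C) : M <> M' ->
  square_summable (combine q p M) -> square_summable (combine q p M') ->
  square_summable p.
Proof.
  intros Hne H H'.
  assert (D : (0 < Cmod (M - M'))%R).
  { apply Cmod_gt_0. intros E. apply Hne.
    replace M with (M - M' + M') by ring. rewrite E. ring. }
  apply (ex_series_le (K := R_AbsRing) (V := R_CompleteNormedModule)) with
    (fun n => scal (2 / Cmod (M - M') ^ 2)%R
                (plus (norm2 (combine q p M) n) (norm2 (combine q p M') n))).
  - intros n. change (norm (norm2 p n)) with (Rabs (norm2 p n)).
    rewrite Rabs_pos_eq by apply norm2_ge0.
    change (scal ?a ?b) with (a * b)%R. change plus with Rplus.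
    pose proof (norm2_combine_sub q p M M' n).
    apply Rmult_le_reg_l with (1 := pow_lt _ 2 D).
    eapply Rle_trans; [eassumption |]. right. field. lra.
  - apply (ex_series_scal (V := R_NormedModule)).
    apply (ex_series_plus (V := R_NormedModule)); assumption.
Qed.

Lemma square_summable_coefficient_exists_unique (tau t : R) (p r q s : nat -> C) :
  (0 < tau)%R -> (0 < t)%R -> tau <> t -> alternating tau t p r ->
  (forall M, alternating tau t (combine q p M) (combine s r M)) ->
  norm2 p 0 = (t * norm2 r 0)%R -> r O <> RtoC 0 ->
  exists! M, square_summable (combine q p M) /\ square_summable (combine s r M).
Proof.
  assert (W : forall tau t p r q s, (0 < tau < t)%R -> alternating tau t p r ->
    (forall M, alternating tau t (combine q p M) (combine s r M)) ->
    norm2 p 0 = (t * norm2 r 0)%R -> r O <> RtoC 0 ->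
    exists! M, square_summable (combine q p M) /\ square_summable (combine s r M)).
  { clear. intros tau t p r q s Htt Hpr Hqs H0 Hr0.
    destruct (square_summable_coefficient_exists tau t p r q s) as [M [HM1 HM2]];
      try assumption.
    exists M. split; [now split |]. intros M' [HM1' HM2'].
    destruct (Ceq_dec M M') as [E | E]; [exact E | exfalso].
    apply (alternating_not_summable tau t p r); try assumption; [lra | |].
    - now apply (square_summable_combine_sub q p M M').
    - now apply (square_summable_combine_sub s r M M'). }
  intros Htau Ht Hne Hpr Hqs H0 Hr0.
  destruct (Rlt_le_dec tau t) as [L | L]; [now apply (W tau t) |].
  assert (Hp0 : p O <> RtoC 0).
  { intros E. unfold norm2 in H0. rewrite E, Cmod_0 in H0.
    assert (0 < Cmod (r O) ^ 2)%R by now apply pow_lt, Cmod_gt_0. nra. }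
  (* For [t < tau] the roles of the two components are exchanged; isotropy at [0] then reads
     [|r|^2 = |p|^2 / t], and the nonvanishing needed is that of [p] at [0]. *)
  destruct (W (/ tau) (/ t) r p s q)%R as [M [[HM1 HM2] HM]].
  - split; [now apply Rinv_0_lt_compat | apply Rinv_lt_contravar; nra].
  - apply alternating_swap; (assumption || lra).
  - intros M. apply alternating_swap; (apply Hqs || lra).
  - rewrite H0. field. lra.
  - exact Hp0.
  - exists M. split; [now split |]. intros M' [HM1' HM2']. apply HM. now split.
Qed.

(** * From the transfer matrices to alternating weights *)

Definition weight (z : C) (k : Z) : R := if Z.odd k then (Cmod z ^ 2)%R else 1%R.

(** With [w = zeta v] the matrix loses its [zeta]. After multiplication by [rho^2 = 1 - |a|^2], both
    sides equal [rho^2] times the original ones and reduce to [|u|^2 + |w|^2 + 2 Re (a u conj w)].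
    Odd sites use [zeta = z], even ones [zeta = 1] with [a] conjugated. *)
Lemma transfer_identity (a zeta u v : C) (rho : R) :
  (rho * rho = 1 - Cmod a ^ 2)%R -> (0 < rho)%R -> zeta <> RtoC 0 ->
  (Cmod ((a * u + zeta * v) / rho) ^ 2 + Cmod u ^ 2
   = Cmod zeta ^ 2 * (Cmod ((1 / zeta * u + Cconj a * v) / rho) ^ 2 + Cmod v ^ 2))%R.
Proof.
  intros Hrho Hpos Hz.
  set (w := zeta * v).
  assert (Hr0 : RtoC rho <> RtoC 0) by (intros E; apply RtoC_inj in E; lra).
  rewrite Rmult_plus_distr_l, <- !Rpow_mult_distr, <- !Cmod_mult.
  replace (zeta * ((1 / zeta * u + Cconj a * v) / rho)) with ((u + Cconj a * w) / rho)
    by (unfold w; field; now split).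
  fold w. rewrite !Cmod_div by exact Hr0. rewrite Cmod_R, Rabs_pos_eq by lra.
  apply Rmult_eq_reg_r with (rho * rho)%R; [| nra].
  transitivity (Cmod (a * u + w) ^ 2 + (rho * rho) * Cmod u ^ 2)%R; [field; lra |].
  transitivity (Cmod (u + Cconj a * w) ^ 2 + (rho * rho) * Cmod w ^ 2)%R; [| field; lra].
  rewrite Hrho, !Cmod_sqr. destruct a, u, w. simpl. ring.
Qed.

Lemma solution_weight (alpha : Z -> C) (z : C) (u v : Z -> C) :
  (forall k, (Cmod (alpha k) < 1)%R) -> z <> RtoC 0 -> is_solution alpha z u v ->
  forall k, (Cmod (u k) ^ 2 + Cmod (u (k - 1)%Z) ^ 2
    = weight z k * (Cmod (v k) ^ 2 + Cmod (v (k - 1)%Z) ^ 2))%R.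
Proof.
  intros Ha Hz H k. rewrite (is_solution_step alpha Ha) in H.
  specialize (H k). unfold step in H. unfold weight.
  assert (Hr := rho_pos alpha Ha k).
  assert (Hs : (rho alpha k * rho alpha k = 1 - Cmod (alpha k) ^ 2)%R).
  { unfold rho. apply sqrt_sqrt. pose proof (Cmod_ge_0 (alpha k)).
    specialize (Ha k). nra. }
  destruct (Z.odd k); injection H as -> ->.
  - now apply transfer_identity.
  - pose proof (transfer_identity (Cconj (alpha k)) 1 (u (k - 1)%Z) (v (k - 1)%Z)
      (rho alpha k)) as T1.
    rewrite Cmod_conj, Cconj_conj, Cmod_1 in T1.
    replace (1 ^ 2)%R with 1%R in T1 by ring.
    replace (1 / 1 * u (k - 1)%Z) with (u (k - 1)%Z) in T1 by field.
    replace (1 * v (k - 1)%Z) with (v (k - 1)%Z) in T1 by ring.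
    apply T1; [exact Hs | exact Hr | apply C1_nz].
Qed.

Lemma is_solution_combine (alpha : Z -> C) (z M : C) (p r q s : Z -> C) :
  (forall k, (Cmod (alpha k) < 1)%R) -> is_solution alpha z p r -> is_solution alpha z q s ->
  is_solution alpha z (fun k => q k + M * p k) (fun k => s k + M * r k).
Proof.
  intros Ha. rewrite !(is_solution_step alpha Ha). intros Hp Hq k.
  specialize (Hp k). specialize (Hq k). unfold step in *.
  destruct (Z.odd k); injection Hp as -> ->; injection Hq as -> ->;
    f_equal; unfold Cdiv; ring.
Qed.

Lemma weight_pos (z : C) (k : Z) : z <> RtoC 0 -> (0 < weight z k)%R.
Proof.
  intros Hz. unfold weight. destruct (Z.odd k); [apply pow_lt, Cmod_gt_0, Hz | lra].
Qed.

Lemma weight_parity (z : C) (k k' : Z) : Z.odd k = Z.odd k' -> weight z k = weight z k'.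
Proof. unfold weight. now intros ->. Qed.

(** The two weights are [|z|^2] and [1]; here the exclusion of the unit circle enters. *)
Lemma weight_neq (z : C) (k k' : Z) : Cmod z <> 1%R -> Z.odd k = negb (Z.odd k') ->
  weight z k <> weight z k'.
Proof.
  unfold weight. intros Hz ->. pose proof (Cmod_ge_0 z).
  destruct (Z.odd k'); simpl; intros E; apply Hz; nra.
Qed.

Lemma half_line_right (alpha : Z -> C) (z : C) (u v : Z -> C) (k : Z) :
  (forall k, (Cmod (alpha k) < 1)%R) -> z <> RtoC 0 -> is_solution alpha z u v ->
  alternating (weight z (k + 1)) (weight z k)
    (fun n => u (k + Z.of_nat n)%Z) (fun n => v (k + Z.of_nat n)%Z).
Proof.
  intros Ha Hz H n. pose proof (solution_weight _ _ _ _ Ha Hz H) as W.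
  unfold norm2. split.
  - rewrite (weight_parity z (k + 1) (k + Z.of_nat (S (2 * n)))).
    + specialize (W (k + Z.of_nat (S (2 * n)))%Z).
      replace (k + Z.of_nat (S (2 * n)) - 1)%Z with (k + Z.of_nat (2 * n))%Z in W by lia.
      lra.
    + replace (Z.of_nat (S (2 * n))) with (1 + 2 * Z.of_nat n)%Z by lia.
      now rewrite !Z.odd_add, Z.odd_mul.
  - rewrite (weight_parity z k (k + Z.of_nat (2 * S n))).
    + specialize (W (k + Z.of_nat (2 * S n))%Z).
      replace (k + Z.of_nat (2 * S n) - 1)%Z with (k + Z.of_nat (S (2 * n)))%Z in W by lia.
      lra.
    + replace (Z.of_nat (2 * S n)) with (2 * Z.of_nat (S n))%Z by lia.
      rewrite !Z.odd_add, Z.odd_mul. now destruct (Z.odd k).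
Qed.

(** The step between [j - 1] and [j] carries the weight of [j], its right end. Started at [k - 1]
    and moving left, the first step has the weight of [k - 1] and the second that of [k - 2], which
    has the parity of [k]. *)
Lemma half_line_left (alpha : Z -> C) (z : C) (u v : Z -> C) (k : Z) :
  (forall k, (Cmod (alpha k) < 1)%R) -> z <> RtoC 0 -> is_solution alpha z u v ->
  alternating (weight z (k - 1)) (weight z k)
    (fun n => u (k - Z.of_nat (S n))%Z) (fun n => v (k - Z.of_nat (S n))%Z).
Proof.
  intros Ha Hz H n. pose proof (solution_weight _ _ _ _ Ha Hz H) as W.
  unfold norm2. split.
  - rewrite (weight_parity z (k - 1) (k - Z.of_nat (S (2 * n)))).
    + specialize (W (k - Z.of_nat (S (2 * n)))%Z).
      replace (k - Z.of_nat (S (2 * n)) - 1)%Z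
        with (k - Z.of_nat (S (S (2 * n))))%Z in W by lia.
      exact W.
    + replace (Z.of_nat (S (2 * n))) with (1 + 2 * Z.of_nat n)%Z by lia.
      now rewrite !Z.odd_sub, Z.odd_add, Z.odd_mul.
  - rewrite (weight_parity z k (k - Z.of_nat (S (S (2 * n))))).
    + specialize (W (k - Z.of_nat (S (S (2 * n))))%Z).
      replace (k - Z.of_nat (S (S (2 * n))) - 1)%Z
        with (k - Z.of_nat (S (2 * S n)))%Z in W by lia.
      exact W.
    + replace (Z.of_nat (S (S (2 * n)))) with (2 * Z.of_nat (S n))%Z by lia.
      rewrite !Z.odd_sub, Z.odd_mul. now destruct (Z.odd k).
Qed.

(** * Coefficient functions and the two half-lines *)

(** Description selects the values and extensionality gives uniqueness, so each [z] can be treated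
    separately. *)
Lemma exists_unique_function (A B : Type) (P : A -> B -> Prop) :
  (forall a, exists! b, P a b) -> exists! f : A -> B, forall a, P a (f a).
Proof.
  intros H.
  exists (fun a => proj1_sig (constructive_indefinite_description _ (H a))). split.
  - intros a. apply (proj2_sig (constructive_indefinite_description _ (H a))).
  - intros g Hg. apply functional_extensionality. intros a.
    now apply (proj2_sig (constructive_indefinite_description _ (H a))).
Qed.

Lemma exists_unique_iff (B : Type) (P Q : B -> Prop) :
  (forall b, P b <-> Q b) -> (exists! b, P b) -> exists! b, Q b.
Proof.
  intros H (b & Hb & U). exists b. split; [now apply H |].
  intros c Hc. now apply U, H.
Qed.

Lemma ell2_left_pred (k : Z) (f : Z -> C) :
  ell2_left k f <-> square_summable (fun n => f (k - Z.of_nat (S n))%Z).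
Proof.
  apply (ex_series_incr_1 (V := R_NormedModule) (fun n => Cmod (f (k - Z.of_nat n)%Z) ^ 2)%R).
Qed.

Theorem theorem2p18 :
  forall (alpha : Z -> C) (halpha : forall k : Z, (Cmod (alpha k) < 1)%R)
         (k0 : Z) (p r q s : C -> Z -> C)
         (hsys : laurent_system alpha k0 p r q s),
    (exists! Mplus : off_circle -> C,
       forall z : off_circle,
         ell2_right k0 (fun k => q (point z) k + Mplus z * p (point z) k)%C /\
         ell2_right k0 (fun k => s (point z) k + Mplus z * r (point z) k)%C) /\
    (exists! Mminus : off_circle -> C,
       forall z : off_circle,
         ell2_left k0 (fun k => q (point z) k + Mminus z * p (point z) k)%C /\
         ell2_left k0 (fun k => s (point z) k + Mminus z * r (point z) k)%C).
Proof.
  intros alpha halpha k0 p r q s hsys.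
  (* The last clause is the isotropy of [(p, r)] at [k0]; it holds for both parities because
     [|p| = |z|] at odd [k0] and [|p| = 1] at even [k0]. *)
  assert (I : forall z : C, z <> RtoC 0 -> is_solution alpha z (p z) (r z) /\
    is_solution alpha z (q z) (s z) /\ r z k0 = RtoC 1 /\
    (Cmod (p z k0) ^ 2 = weight z k0 * Cmod (r z k0) ^ 2)%R).
  { intros z Hz. destruct (hsys z Hz) as (Hp & Hq & H0).
    split; [exact Hp | split; [exact Hq |]]. unfold weight.
    destruct (Z.odd k0); destruct H0 as (-> & -> & _);
      (split; [reflexivity | rewrite Cmod_1; ring]). }
  split.
  - apply (exists_unique_function _ _ (fun z M =>
      ell2_right k0 (fun k => q (point z) k + M * p (point z) k) /\
      ell2_right k0 (fun k => s (point z) k + M * r (point z) k))).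
    intros [z [Hz Hz1]]. simpl. destruct (I z Hz) as (Hp & Hq & Hr & H0).
    apply (square_summable_coefficient_exists_unique (weight z (k0 + 1)) (weight z k0)
      (fun n => p z (k0 + Z.of_nat n)%Z) (fun n => r z (k0 + Z.of_nat n)%Z)
      (fun n => q z (k0 + Z.of_nat n)%Z) (fun n => s z (k0 + Z.of_nat n)%Z)).
    + now apply weight_pos.
    + now apply weight_pos.
    + apply weight_neq; [exact Hz1 |]. rewrite Z.odd_add. now destruct (Z.odd k0).
    + now apply (half_line_right alpha).
    + intros M. apply (half_line_right alpha z (fun k => q z k + M * p z k)
        (fun k => s z k + M * r z k)); [assumption.. | now apply is_solution_combine].
    + unfold norm2. simpl Z.of_nat. rewrite Z.add_0_r. exact H0.
    + simpl Z.of_nat. rewrite Z.add_0_r, Hr. apply C1_nz.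
  - apply (exists_unique_function _ _ (fun z M =>
      ell2_left k0 (fun k => q (point z) k + M * p (point z) k) /\
      ell2_left k0 (fun k => s (point z) k + M * r (point z) k))).
    intros [z [Hz Hz1]]. simpl. destruct (I z Hz) as (Hp & Hq & Hr & H0).
    (* [(p, r)] is isotropic at [k0] only for the form of weight [weight z k0], and that
       form is also isotropic at [k0 - 1], where the left half-line can thus be started. *)
    apply (exists_unique_iff _ (fun M =>
      square_summable (fun n => q z (k0 - Z.of_nat (S n))%Z + M * p z (k0 - Z.of_nat (S n))%Z) /\
      square_summable (fun n => s z (k0 - Z.of_nat (S n))%Z + M * r z (k0 - Z.of_nat (S n))%Z))).
    { intros M. now rewrite !ell2_left_pred. }
    (* Isotropy at [k0] is subtracted from the weight identity for the step between [k0 - 1] and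
       [k0]. *)
    assert (E : (Cmod (p z (k0 - 1)%Z) ^ 2 = weight z k0 * Cmod (r z (k0 - 1)%Z) ^ 2)%R).
    { pose proof (solution_weight _ _ _ _ halpha Hz Hp k0). lra. }
    apply (square_summable_coefficient_exists_unique (weight z (k0 - 1)) (weight z k0)
      (fun n => p z (k0 - Z.of_nat (S n))%Z) (fun n => r z (k0 - Z.of_nat (S n))%Z)
      (fun n => q z (k0 - Z.of_nat (S n))%Z) (fun n => s z (k0 - Z.of_nat (S n))%Z)).
    + now apply weight_pos.
    + now apply weight_pos.
    + apply weight_neq; [exact Hz1 |]. rewrite Z.odd_sub. now destruct (Z.odd k0).
    + now apply (half_line_left alpha).
    + intros M. apply (half_line_left alpha z (fun k => q z k + M * p z k)
        (fun k => s z k + M * r z k)); [assumption.. | now apply is_solution_combine].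
    + exact E.
    (* If [r] vanished at [k0 - 1], then so would [p] by [E], and the transfer step would give
       [r = 0] at [k0], where [r = 1]. *)
    + change (r z (k0 - 1)%Z <> RtoC 0). intros R0.
      rewrite R0, Cmod_0 in E.
      assert (P0 : p z (k0 - 1)%Z = RtoC 0).
      { apply Cmod_eq_0. pose proof (Cmod_ge_0 (p z (k0 - 1)%Z)). nra. }
      rewrite (is_solution_step alpha halpha) in Hp. specialize (Hp k0). rewrite R0, P0, Hr in Hp.
      apply C1_nz. apply (f_equal snd) in Hp.
      unfold step in Hp. transitivity (snd (p z k0, RtoC 1)); [reflexivity |].
      rewrite Hp. destruct (Z.odd k0); cbn [snd]; unfold Cdiv; ring.
Qed.
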